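(* Let $n\ge 2$ and let $\varepsilon$ be an $n$-periodic sign function. Every $n$-periodic tree $\mathcal{T}$ with sign function $\varepsilon$ admits an $n$-periodic morphism $\psi:P_{\mathcal{T}}\to\mathbb{R}$. Therefore $\mathcal{R}(\mathcal{T})$ is a nonempty convex open subset of $V_n(\mathbb{Z})\cong\mathbb{R}^{n+1}$.
   Context: $\varepsilon:\mathbb{Z}\to\{+,-\}$ is $n$-periodic if $\varepsilon_{i+n}=\varepsilon_i$. An $n$-periodic poset is a set $P=\{p_i : i\in\mathbb{Z}\}$ (distinct $p_i$) with a partial order such that $p_i<p_j\Leftrightarrow p_{i+n}<p_{j+n}$. $p$ is a child of $q$ (and $q$ a parent of $p$) if $p<q$ and no $x$ satisfies $p<x<q$. The Hasse diagram is the directed graph with vertex set $P$ and an edge from each child to each of its parents; it is required that whenever $p<q$ there is a directed path from $p$ to $q$. An edge with endpoints $p_i,p_j$, $i<j$, is written $\ell=(p_i,p_j)$. It has positive slope if $p_i<p_j$ ($p_j$ is then a right parent of $p_i$, and $p_i$ a left child of $p_j$) and negative slope if $p_i>p_j$ ($p_j$ is a right child of $p_i$, and $p_i$ a left parent of $p_j$). An $n$-periodic tree with sign function $\varepsilon$ is the Hasse diagram $\mathcal{T}$ of an $n$-periodic poset $P=P_{\mathcal{T}}$ such that the underlying graph is a tree (connected, no cycles) and: (T1) each $p_i$ has at most one left parent, at most one right parent, at most one left child, at most one right child; (T2) if $\varepsilon_i=+$ then $p_i$ has at most one parent; (T3) if $\varepsilon_i=-$ then $p_i$ has at most one child; (T4)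 for every edge $(p_i,p_j)$ and every $i<k<j$: (a) if $p_k<p_i$ and $p_k<p_j$ then $\varepsilon_k=+$; (b) if $p_k>p_i$ and $p_k>p_j$ then $\varepsilon_k=-$. An $n$-periodic function is a map $\psi:P\to\mathbb{R}$ such that $m=\psi(p_{i+n})-\psi(p_i)$ is independent of $i$. It is an $n$-periodic morphism if moreover $\psi(p_i)<\psi(p_j)$ whenever $p_i<p_j$. $V_n(\mathbb{Z})$ is the vector space of all $n$-periodic functions on $\mathbb{Z}$ (identified with functions on $P$ via $\pi(i)=\psi(p_i)$), isomorphic to $\mathbb{R}^{n+1}$ via $\pi\mapsto(\pi(1),\dots,\pi(n),\pi(n)-\pi(0))$. $\mathcal{R}(\mathcal{T})\subseteq V_n(\mathbb{Z})$ is the set of all $n$-periodic morphisms on $P_{\mathcal{T}}$. *)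

(* Defs.v *)
From HB Require Import structures.
From mathcomp Require Import all_boot all_order all_algebra.
From mathcomp Require Import all_classical all_reals all_analysis.
Set Implicit Arguments.
Unset Strict Implicit.
Unset Printing Implicit Defensive.
Import Order.TTheory GRing.Theory Num.Theory.
Import numFieldNormedType.Exports.
Local Open Scope classical_set_scope.
Local Open Scope ring_scope.

Variant sign := Plus | Minus.

Definition periodic_sign (n : nat) (eps : int -> sign) : Prop :=
  forall i, eps (i + n%:Z) = eps i.

Section Poset.
Variables (d : Order.disp_t) (P : porderType d).

Definition child : rel P :=
  fun x y => `[< (x < y)%O /\ ~ exists z, (x < z)%O /\ (z < y)%O >].

Definition adjacent : rel P := fun x y => child x y || child y x.

Definition connected_graph : Prop :=
  forall x y, exists s, path adjacent x s /\ last x s = y.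

(* Two-element [ucycle]s only go back and forth along one edge. *)
Definition acyclic_graph : Prop :=
  forall s, ucycle adjacent s -> (size s <= 2)%N.

(* A poset P = {p_i : i in Z} is given by a bijective enumeration p. *)
Record periodic_poset (n : nat) (p : int -> P) : Prop := PeriodicPoset {
  enum_bij : bijective p;
  order_shift : forall i j,
    (p i < p j)%O <-> (p (i + n%:Z) < p (j + n%:Z))%O;
  hasse_path : forall x y, (x < y)%O ->
    exists s, path child x s /\ last x s = y }.

Section Edges.
Variable p : int -> P.

(* [left_parent i j]: p_j is a left parent of p_i; similarly below. *)
Definition left_parent (i j : int) : Prop := j < i /\ child (p i) (p j).
Definition right_parent (i j : int) : Prop := i < j /\ child (p i) (p j).
Definition left_child (i j : int) : Prop := j < i /\ child (p j) (p i).
Definition right_child (i j : int) : Prop := i < j /\ child (p j) (p i).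
Definition parent (i j : int) : Prop := child (p i) (p j).
Definition is_child (i j : int) : Prop := child (p j) (p i).

Definition at_most_one (Q : int -> Prop) : Prop :=
  forall j k, Q j -> Q k -> j = k.

Record periodic_tree (n : nat) (eps : int -> sign) : Prop := PeriodicTree {
  tree_poset : periodic_poset n p;
  tree_connected : connected_graph;
  tree_acyclic : acyclic_graph;
  tree_one_per_side : forall i,
    [/\ at_most_one (left_parent i), at_most_one (right_parent i),
        at_most_one (left_child i) & at_most_one (right_child i)];
  tree_plus_parent : forall i, eps i = Plus -> at_most_one (parent i);
  tree_minus_child : forall i, eps i = Minus -> at_most_one (is_child i);
  tree_no_crossing : forall i j k, adjacent (p i) (p j) -> i < k -> k < j ->
    ((p k < p i)%O -> (p k < p j)%O -> eps k = Plus) /\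
    ((p i < p k)%O -> (p j < p k)%O -> eps k = Minus) }.
End Edges.
End Poset.

Definition periodic_function (R : realType) (n : nat) (T : Type)
    (p : int -> T) (psi : T -> R) : Prop :=
  exists m : R, forall i : int, psi (p (i + n%:Z)) - psi (p i) = m.

Definition periodic_morphism (R : realType) (n : nat) (d : Order.disp_t)
    (P : porderType d) (p : int -> P) (psi : P -> R) : Prop :=
  periodic_function n p psi /\
  forall i j, (p i < p j)%O -> psi (p i) < psi (p j).

Definition periodic_on_int (R : realType) (n : nat) : {pred int -> R^o} :=
  fun f => `[< periodic_function n id (f : int -> R) >].

(* The space V_n(Z); R^o is R seen as a module over itself. *)
Record Vn (R : realType) (n : nat) := MkVn {
  Vn_fun :> int -> R^o;
  Vn_periodic : Vn_fun \in @periodic_on_int R n }.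

Section VnSpace.
Variables (R : realType) (n : nat).

HB.instance Definition _ := [isSub for @Vn_fun R n].
HB.instance Definition _ := [Choice of Vn R n by <:].

Fact periodic_on_int_submod : submod_closed (@periodic_on_int R n).
Proof.
split; first by apply/asboolP; exists 0 => i; rewrite subrr.
move=> a f g /asboolP[mf hf] /asboolP[mg hg]; apply/asboolP.
exists (a * mf + mg) => i; rewrite -(hf i) -(hg i) mulrBr.
by rewrite addrACA -opprD.
Qed.
HB.instance Definition _ :=
  GRing.isSubmodClosed.Build R (int -> R^o) (@periodic_on_int R n)
    periodic_on_int_submod.
HB.instance Definition _ := [SubChoice_isSubLmodule of Vn R n by <:].

(* pi |-> (pi(1), ..., pi(n), pi(n) - pi(0)) *)
Definition Vn_coord (v : Vn R n) : 'rV[R]_n.+1 :=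
  \row_(i < n.+1) if (i < n)%N then v i.+1%:Z else v n%:Z - v 0.

Lemma Vn_coord_linear : linear Vn_coord.
Proof.
move=> a u v; apply/rowP => i; rewrite !mxE; case: ifP => // _.
by rewrite mulrBr addrACA -opprD.
Qed.

Lemma Vn_shift (v : Vn R n) (i q : int) :
  v (i + q * n%:Z) = v i + q%:~R * (v n%:Z - v 0).
Proof.
have /asboolP[m hm] := Vn_periodic v.
rewrite -[X in v X - _]add0r (hm 0).
have H k : v (k + n%:Z) = v k + m by rewrite -(hm k) /= subrKC.
elim/int_rec: q => [|q IH|q IH].
- by rewrite !mul0r !addr0.
- by rewrite intS mulrDl mul1r addrCA addrC H IH rmorphD mulrDl mul1r addrAC addrA.
- have E : i + - q.+1%:Z * n%:Z + n%:Z = i + - q%:Z * n%:Z.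
    rewrite intS opprD [_ - q%:Z]addrC mulrDl mulN1r -!addrA addNr.
    by rewrite [_ + 0]addr0.
  have := H (i + - q.+1%:Z * n%:Z); rewrite E IH => /esym/(canRL (addrK m)) ->.
  by rewrite intS opprD [_ - q%:Z]addrC rmorphD rmorphN1 mulrDl mulN1r addrA.
Qed.

Lemma Vn_coord_bij : (0 < n)%N -> bijective Vn_coord.
Proof.
move=> n0; have nz : n%:Z != 0 by rewrite eqz_nat -lt0n.
have modb k : (`|(k %% n%:Z)%Z| < n)%N.
  by rewrite -ltz_nat gez0_abs ?modz_ge0// ltz_pmod// ltz_nat.
have modE k : `|(k %% n%:Z)%Z|%:Z = (k %% n%:Z)%Z by rewrite gez0_abs ?modz_ge0.
pose g (w : 'rV[R]_n.+1) (k : int) : R^o :=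
  w 0 (inord `|((k - 1) %% n%:Z)%Z|) + ((k - 1) %/ n%:Z)%Z%:~R * w 0 ord_max.
have gP w k : g w (k + n%:Z) - g w k = w 0 ord_max.
  rewrite /g [k + _ - 1]addrAC; move: (k - 1) => {}k; rewrite modzDr divzDr ?dvdzz// divzz nz.
  by rewrite rmorphD mulrDl mul1r addrA [X in X - _]addrC addrK.
have gV w : g w \in @periodic_on_int R n.
  by apply/asboolP; exists (w 0 ord_max) => k; exact: gP.
exists (fun w => MkVn (gV w)) => [v|w].
  apply: val_inj; apply/funext => k /=; rewrite /g !mxE /= ltnn.
  rewrite inordK; last exact: leq_trans (modb _) _.
  rewrite modb -Vn_shift; congr (v _).
  by rewrite -addn1 PoszD modE addrAC [X in X + 1]addrC -divz_eq subrK.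
apply/rowP => i; rewrite mxE; case: ifPn => [lin|].
  rewrite /= /g intS [1 + _]addrC addrK divz_small ?modz_small ?ltz_nat//.
  by rewrite mul0r addr0 absz_nat inord_val.
rewrite -leqNgt => nlei; have -> : i = ord_max.
  by apply/val_inj/eqP; rewrite /= eqn_leq nlei -ltnS ltn_ord.
by rewrite /= -[X in g w X - _]add0r gP.
Qed.

(* V_n(Z) carries the topology of R^(n+1) transported along [Vn_coord]. *)
HB.instance Definition _ := Topological.copy (Vn R n)
  (initial_topology Vn_coord).
End VnSpace.

Definition morphism_region (R : realType) (n : nat) (d : Order.disp_t)
    (P : porderType d) (p : int -> P) : set (Vn R n) :=
  [set v | exists psi : P -> R,
     periodic_morphism n p psi /\ forall i, v i = psi (p i)].
Arguments morphism_region R n {d P} p.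

(* Main.v *)
Require Import Defs.
From mathcomp Require Import all_boot all_order all_algebra.
From mathcomp Require Import all_classical all_reals all_analysis.
Import Order.TTheory GRing.Theory Num.Theory.
Import numFieldNormedType.Exports.
Local Open Scope classical_set_scope.
Local Open Scope ring_scope.

(** The Hasse diagram is a tree, so any antisymmetric weight on its oriented
edges is the difference of a potential: a closed walk visiting some vertex
twice splits there into two shorter closed walks, and a closed walk without
repetition goes back and forth along one edge, so the weight of every closed
walk vanishes ([closed_walk_weight]) and the weight of a walk depends on its
ends only ([tree_potential]). Giving weight 1 to the edge from each child to
its parent yields a potential psi that increases along the order. Translation
by n preserves the weights, so psi (p_(i+n)) - psi (p_i) takes the same value
at adjacent vertices, and it is constant because the tree is connected
([exists_periodic_morphism]).

As p < q forces a chain of children from p to q, the region of periodic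
morphisms is cut out of V_n(Z) by the inequalities v i < v j over the edges
from a child p_i to a parent p_j ([morphism_regionP]). These are open
half-spaces, so the region is convex. By periodicity only the edges whose child
is one of p_0, ..., p_(n-1) matter, and each such vertex has at most one left
and one right parent; finitely many half-spaces remain, and the region is
open. *)

(** * Potentials on trees *)

Section Potential.
Variables (T : eqType) (V : zmodType) (e : rel T) (w : T -> T -> V).
Hypothesis e_irr : irreflexive e.
Hypothesis w_anti : forall x y, e x y -> w y x = - w x y.

Definition walk_weight (x : T) (s : seq T) : V := \sum_(c <- pairmap w x s) c.

Lemma walk_weight_cat x s t :
  walk_weight x (s ++ t) = walk_weight x s + walk_weight (last x s) t.
Proof. by rewrite /walk_weight pairmap_cat big_cat. Qed.

Lemma walk_weight_cons x y s :
  walk_weight x (y :: s) = w x y + walk_weight y s.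
Proof. by rewrite /walk_weight /= big_cons. Qed.

Hypothesis e_acyclic : forall s, ucycle e s -> (size s <= 2)%N.

(** Induction on length: a repeated vertex cuts the walk into two shorter
closed walks, and otherwise acyclicity leaves at most one edge, whose two
opposite weights cancel. *)
Lemma closed_walk_weight x s : path e x s -> last x s = x ->
  walk_weight x s = 0.
Proof.
have [k] := ubnP (size s); elim: k x s => // k IH x s.
rewrite ltnS => sk xs lx.
have [us|] := boolP (uniq s).
  case/lastP: s => [|s y] in xs lx us sk *; first by rewrite /walk_weight big_nil.
  rewrite last_rcons in lx; subst y.
  have cyc : ucycle e (x :: s).
    by rewrite /ucycle /= xs -rcons_uniq.
  have := e_acyclic _ cyc; case: s => [|y [|//]] in xs {us sk cyc} * => _.
    by move: xs; rewrite /= e_irr.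
  move: xs => /= /andP[exy _].
  by rewrite !walk_weight_cons (w_anti _ _ exy) /walk_weight big_nil addr0 subrr.
case/(uniqPn x) => i [j [ij js E]].
(* The walk revisits z at positions i < j of s, so s = s1 ++ s2 ++ s3 where
   s2 is a nonempty closed walk at z and s1 ++ s3 is the walk without it. *)
pose z := nth x s i.
have Es : s = take i.+1 s ++ take (j - i) (drop i.+1 s) ++ drop j.+1 s.
  rewrite -[drop j.+1 s](_ : drop (j - i) (drop i.+1 s) = _); last first.
    by rewrite drop_drop addnS subnK// ltnW.
  by rewrite !cat_take_drop.
have is_ := ltn_trans ij js.
have l1 : last x (take i.+1 s) = z by rewrite (take_nth x)// last_rcons.
have l2 : last z (take (j - i) (drop i.+1 s)) = z.
  have -> : (j - i)%N = (j - i.+1).+1 by rewrite subnSK.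
  rewrite (take_nth x) ?last_rcons ?nth_drop ?subnKC//.
  by rewrite size_drop ltn_sub2r// (leq_ltn_trans ij).
have sz : size s = (size (take i.+1 s) + size (take (j - i) (drop i.+1 s))
                    + size (drop j.+1 s))%N.
  by rewrite {1}Es !size_cat addnA.
have n1 : (0 < size (take i.+1 s))%N by rewrite size_takel.
have n2 : (0 < size (take (j - i) (drop i.+1 s)))%N.
  rewrite size_take_min size_drop leq_min !subn_gt0 ij /=.
  exact: leq_ltn_trans ij js.
move: xs lx; rewrite Es !cat_path !last_cat !walk_weight_cat l1 l2.
case/and3P=> p1 p2 p3 lx.
rewrite (IH z (take _ (drop _ _)))// ?add0r; last first.
  apply: leq_trans sk; rewrite sz -addnA addnC -addnA -addn1 leq_add2l.
  by rewrite addn_gt0 n1 orbT.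
rewrite -l1 -walk_weight_cat; apply: IH.
- apply: leq_trans sk; rewrite sz size_cat ltn_add2r -addn1 leq_add2l.
  exact: n2.
- by rewrite cat_path p1 l1.
- by rewrite last_cat l1.
Qed.

Hypothesis e_conn : forall x y, exists s, path e x s /\ last x s = y.

(** Closing up two walks with the same ends by a common return walk shows that
they have the same weight, so the weight of any walk from a base point may be
taken as the potential. *)
Lemma tree_potential (o : T) :
  exists f : T -> V, forall x y, e x y -> f y - f x = w x y.
Proof.
have [g gP] := choice (e_conn o).
exists (fun x => walk_weight o (g x)) => x y exy.
have [t [yt lt]] := e_conn y o.
have [ox lx] := gP x; have [oy ly] := gP y.
have W1 : walk_weight o (g y ++ t) = 0.
  by apply: closed_walk_weight; rewrite ?cat_path ?last_cat ly// oy.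
have W2 : walk_weight o (g x ++ y :: t) = 0.
  by apply: closed_walk_weight; rewrite ?cat_path ?last_cat lx//= ox exy.
move: W1; rewrite -W2 !walk_weight_cat walk_weight_cons lx ly addrA.
by move=> /addIr ->; rewrite addrAC subrr add0r.
Qed.

End Potential.

(** * Existence of a periodic morphism *)

Section Hasse.
Variables (d : Order.disp_t) (P : porderType d).

Lemma child_lt (x y : P) : child x y -> (x < y)%O.
Proof. by case/asboolP. Qed.

Lemma child_asym (x y : P) : child x y -> child y x = false.
Proof.
by move=> /child_lt xy; apply/negP => /child_lt /(lt_trans xy); rewrite ltxx.
Qed.

Lemma adjacent_irr : irreflexive (@Defs.adjacent d P).
Proof. by move=> x; apply/negP => /orP[] /child_lt; rewrite ltxx. Qed.

Variables (n : nat) (p : int -> P).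
Hypothesis pP : periodic_poset n p.

Lemma child_shift1 i j :
  child (p i) (p j) = child (p (i + n%:Z)) (p (j + n%:Z)).
Proof.
have [q pK qK] := enum_bij pP.
have S a b : (p (a + n%:Z) < p (b + n%:Z))%O = (p a < p b)%O.
  by apply/idP/idP; case: (order_shift pP a b).
have B a z : (p a < z)%O = (p (a + n%:Z) < p (q z + n%:Z))%O by rewrite S qK.
have B' a z : (z < p a)%O = (p (q z + n%:Z) < p (a + n%:Z))%O by rewrite S qK.
apply/asbool_equiv_eq; rewrite S; split=> -[lij nz]; split=> // -[z [iz zj]].
  apply: nz; exists (p (q z - n%:Z)).
  by split; rewrite -S subrK qK.
by apply: nz; exists (p (q z + n%:Z)); rewrite -B -B'.
Qed.

Lemma child_shift (k i j : int) :
  child (p (i + k * n%:Z)) (p (j + k * n%:Z)) = child (p i) (p j).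
Proof.
elim/int_rec: k => [|k IH|k IH]; first by rewrite !mul0r !addr0.
  have E (a : int) : a + k.+1%:Z * n%:Z = a + k%:Z * n%:Z + n%:Z.
    by rewrite -addn1 PoszD mulrDl mul1r addrA.
  by rewrite !E -child_shift1.
have E (a : int) : a - k%:Z * n%:Z = a - k.+1%:Z * n%:Z + n%:Z.
  by rewrite -addn1 PoszD mulrDl mul1r opprD addrA subrK.
by move: IH; rewrite !mulNr !E -child_shift1.
Qed.

(** The Hasse diagram has a directed path from x to y whenever x < y, so f need
only increase along the edges. *)
Lemma lt_homo_child (d' : Order.disp_t) (Q : porderType d') (f : P -> Q) :
  (forall x y, child x y -> (f x < f y)%O) ->
  forall x y, (x < y)%O -> (f x < f y)%O.
Proof.
move=> fc x y xy; have [s [xs ly]] := hasse_path pP xy.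
case: s => [|z s] in xs ly; first by move: xy; rewrite -ly ltxx.
move: xs => /= /andP[xz zs]; apply: (lt_le_trans (fc _ _ xz)).
rewrite -{}ly /= {xy xz}; elim: s z zs => //= u s IH z /andP[zu us].
exact: le_trans (ltW (fc _ _ zu)) (IH _ us).
Qed.

(** Take the potential of the weight that is 1 from child to parent; its variation
under translation is the same at the two ends of each edge. *)
Lemma exists_periodic_morphism (R : realType) :
  connected_graph P -> acyclic_graph P ->
  exists psi : P -> R, periodic_morphism n p psi.
Proof.
move=> conn acyc.
pose w (x y : P) : R := (child x y)%:R - (child y x)%:R.
have wN (x y : P) : Defs.adjacent x y -> w y x = - w x y by rewrite /w opprB.
have [psi psiP] := tree_potential _ _ _ _ adjacent_irr wN acyc conn (p 0).
exists psi; split; last first.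
  move=> i j; apply: lt_homo_child => x y xy.
  by rewrite -subr_gt0 psiP /Defs.adjacent ?xy// /w xy child_asym// subr0.
pose h i := psi (p (i + n%:Z)) - psi (p i).
have [q pK qK] := enum_bij pP.
have hadj i j : Defs.adjacent (p i) (p j) -> h i = h j.
  move=> aij; have aij' : Defs.adjacent (p (i + n%:Z)) (p (j + n%:Z)).
    by rewrite /Defs.adjacent -!child_shift1.
  have : psi (p (j + n%:Z)) - psi (p (i + n%:Z)) = psi (p j) - psi (p i).
    by rewrite !psiP// /w -!child_shift1.
  rewrite /h => E; rewrite -(subKr (psi (p (j + n%:Z))) (psi (p (i + n%:Z)))) E.
  by rewrite opprB -addrA [psi (p i) - _ - _]addrAC subrr add0r.
exists (h 0) => i; rewrite -/(h i).
have [s [ps <-]] : exists s, path (@Defs.adjacent d P) (p 0) s /\ q (last (p 0) s) = i.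
  by have [s [ps li]] := conn (p 0) (p i); exists s; rewrite li pK.
rewrite -[0 in RHS]pK; elim: s (p 0) ps => //= y s IH x /andP[xy ys].
by rewrite (IH _ ys); apply/esym/hadj; rewrite !qK.
Qed.
End Hasse.

(** * The region of periodic morphisms *)

Lemma morphism_regionP {R : realType} {n : nat} {d : Order.disp_t}
    {P : porderType d} {p : int -> P} (pP : periodic_poset n p) (v : Vn R n) :
  morphism_region R n p v <-> forall i j, child (p i) (p j) -> v i < v j.
Proof.
split=> [[psi [[_ psi_lt] vE]] i j /child_lt ij|vlt].
  by rewrite !vE; apply: psi_lt.
have [q pK qK] := enum_bij pP.
pose psi x : R := v (q x); exists psi; split; last by move=> i; rewrite /psi pK.
split.
  have /asboolP[m vm] := Vn_periodic v.
  by exists m => i; rewrite /psi !pK; exact: vm.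
move=> i j; apply: (lt_homo_child _ _ _ _ pP _ _ psi) => x y xy.
by rewrite /psi; apply: vlt; rewrite !qK.
Qed.

Section Region.
Variables (R : realType) (n : nat).

Lemma Vn_conv_apply (u v : Vn R n) (t : {i01 R}) (i : int) :
  (conv t (u : convex_lmodType (Vn R n)) v : Vn R n) i =
  conv t (u i : convex_lmodType R^o) (v i).
Proof. by []. Qed.

Lemma region_convex (d : Order.disp_t) (P : porderType d) (p : int -> P) :
  periodic_poset n p -> convex_set (morphism_region R n p).
Proof.
move=> pP u v t /set_mem /(morphism_regionP pP) hu /set_mem.
move=> /(morphism_regionP pP) hv; apply/mem_set/(morphism_regionP pP).
move=> i j ij; rewrite !Vn_conv_apply -subr_gt0.
have -> : conv t (u j : convex_lmodType R^o) (v j) - conv t (u i) (v i)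
    = conv t (u j - u i) (v j - v i).
  by rewrite !convRE !mulrBr addrACA -opprD.
by apply: convR_gt0; rewrite subr_gt0; [exact: hu | exact: hv].
Qed.

Hypothesis n_gt0 : (0 < n)%N.

Lemma Vn_coord_continuous (k : 'I_n.+1) :
  continuous (fun v : Vn R n => Vn_coord v 0 k).
Proof.
move=> v; apply: (@continuous_comp _ _ _ (@Vn_coord R n) (fun M : 'rV[R]_n.+1 => M 0 k)).
  exact: initial_continuous.
exact: coord_continuous.
Qed.

(** Reducing i modulo n to an index between 1 and n expresses v i as a linear
combination of two coordinates of v. *)
Lemma Vn_eval_continuous (i : int) : continuous (fun v : Vn R n => v i : R).
Proof.
pose r := ((i - 1) %% n%:Z)%Z; pose q := ((i - 1) %/ n%:Z)%Z.
have n0 : n%:Z != 0 by rewrite eqz_nat -lt0n.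
have rE : `|r|%:Z = r by rewrite gez0_abs ?modz_ge0.
have rn : (`|r| < n)%N by rewrite -ltz_nat rE ltz_pmod.
have -> : (fun v : Vn R n => v i : R) = fun v : Vn R n =>
    Vn_coord v 0 (inord `|r|) + q%:~R * Vn_coord v 0 ord_max.
  apply/funext => v; rewrite !mxE /= ltnn inordK; last exact: leqW. rewrite rn.
  rewrite -Vn_shift; congr (v _).
  by rewrite -addn1 PoszD rE addrAC [r + _]addrC -divz_eq subrK.
move=> v; have F : Filter (nbhs v) := nbhs_filter v.
apply: cvgD; first exact: Vn_coord_continuous.
by apply: cvgM; [exact: cvg_cst | exact: Vn_coord_continuous].
Qed.

Lemma open_Vn_lt (i j : int) : open [set v : Vn R n | v i < v j].
Proof.
have -> : [set v : Vn R n | v i < v j] =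
    (fun v : Vn R n => v j - v i : R) @^-1` [set x | 0 < x].
  by apply/seteqP; split=> v /=; rewrite subr_gt0.
apply: open_comp; last exact: open_gt.
move=> v _; have F : Filter (nbhs v) := nbhs_filter v.
by apply: cvgB; exact: Vn_eval_continuous.
Qed.

(** With at most one j to test, the condition is a half-space or vacuous; the
bound of one parent per side enters the proof of openness in this form. *)
Lemma open_Vn_lt_unique (i : int) (Q : int -> Prop) : at_most_one Q ->
  open [set v : Vn R n | forall j, Q j -> v i < v j].
Proof.
move=> uQ; have [[j Qj]|nQ] := pselect (exists j, Q j).
  rewrite (_ : mkset _ = [set v : Vn R n | v i < v j]); first exact: open_Vn_lt.
  by apply/seteqP; split=> v /= => [|vij k Qk]; [exact | rewrite (uQ k j)].
rewrite (_ : mkset _ = setT); first exact: openT.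
by apply/seteqP; split=> v //= _ j Qj; case: nQ; exists j.
Qed.

(** Translating an edge until its child lies in [0, n) leaves finitely many
conditions, one for each left or right parent of p_0, ..., p_(n-1). *)
Lemma region_open (d : Order.disp_t) (P : porderType d) (p : int -> P)
    (eps : int -> sign) :
  periodic_tree p n eps -> open (morphism_region R n p).
Proof.
move=> tP; have pP := tree_poset tP.
pose left_lt i := [set v : Vn R n | forall j, left_parent p i j -> v i < v j].
pose right_lt i := [set v : Vn R n | forall j, right_parent p i j -> v i < v j].
have -> : morphism_region R n p =
    \bigcap_(k in `I_n) (left_lt k%:Z `&` right_lt k%:Z).
  apply/seteqP; split=> [v /(morphism_regionP pP) vlt k _|v vlt].
    by split=> j [_ kj]; apply: vlt.
  apply/(morphism_regionP pP) => i j.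
  have n0 : n%:Z != 0 by rewrite eqz_nat -lt0n.
  pose q := (i %/ n%:Z)%Z; pose k := `|(i %% n%:Z)%Z|%N.
  have kE : k%:Z = (i %% n%:Z)%Z by rewrite gez0_abs ?modz_ge0.
  have kn : (k < n)%N by rewrite -ltz_nat kE ltz_pmod.
  have -> : i = k%:Z + q * n%:Z by rewrite kE addrC -divz_eq.
  rewrite -(subrK (q * n%:Z) j); move: (j - _) => {}j.
  rewrite child_shift// !Vn_shift ltrD2r => kj.
  have [vl vr] := vlt k kn.
  case: (ltgtP k%:Z j) => jk; [exact: vr|exact: vl|].
  by move: kj; rewrite jk => /child_lt; rewrite ltxx.
have [U1 U2] : (forall i, at_most_one (left_parent p i)) /\
    (forall i, at_most_one (right_parent p i)).
  by split=> i; have [] := tree_one_per_side tP i.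
rewrite bigcap_mkord; elim/big_ind: _ => [|A B|k _]; first exact: openT.
  exact: openI.
by apply: openI; apply: open_Vn_lt_unique.
Qed.
End Region.

Theorem proposition1p2p5 (R : realType) (n : nat) (n_ge2 : (2 <= n)%N)
    (eps : int -> sign) (eps_periodic : periodic_sign n eps)
    (d : Order.disp_t) (P : porderType d) (p : int -> P)
    (treeP : periodic_tree p n eps) :
  (exists psi : P -> R, periodic_morphism n p psi) /\
  [/\ morphism_region R n p !=set0,
      convex_set (morphism_region R n p) &
      open (morphism_region R n p)].
Proof.
have pP := tree_poset treeP.
have ex := exists_periodic_morphism _ _ _ _ pP R (tree_connected treeP)
  (tree_acyclic treeP).
split=> //; split; last exact: region_open (ltnW n_ge2) _ _ _ _ treeP.
  have [psi [[m psim] psi_lt]] := ex.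
  have fP : (psi \o p : int -> R^o) \in @periodic_on_int R n.
    by apply/asboolP; exists m.
  by exists (MkVn fP), psi; split=> //; split=> //; exists m.
exact: region_convex.
Qed.
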